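(* For every constant $c>0$ there is a constant $C>0$ such that the following holds. Let $\mathcal{G}=(G_1,\dots,G_T)$ be an always-connected temporal graph on $n\ge 2$ vertices whose underlying graph $U$ has a $c$-strict $(r,b)$-division, with $r\ge 2$ and $b\ge 1$, and let $\Delta$ be the average degree of $U$. Put \[ f=n r^{0.5}b^{4}\Delta^{1.5}\log^{1.5}(r)\log(n)+n^{2}\log(n)/r, \] and suppose $T\ge Cf$. Then a single agent, starting at any given vertex, can visit all vertices of $\mathcal{G}$ using only the snapshots $G_1,\dots,G_{\lceil Cf\rceil}$.
   Context: A temporal graph $\mathcal{G}=(G_1,\dots,G_T)$ on a vertex set $V$, $|V|=n$, is a sequence of simple undirected graphs $G_t=(V,E_t)$. It is always-connected if each $G_t$ is connected. Its underlying graph is $U=(V,\bigcup_tE_t)$, with average degree $\Delta=\frac1n\sum_v\deg_U(v)$. A set $S\subseteq V$ is an $(r,b)$-division of a graph $G=(V,E)$ if $V\setminus S$ can be partitioned into parts $C_1,\dots,C_q$ such that: - every edge of $G$ either lies inside one part, or lies inside $S$, or joins a part to $S$; - each part has at most $r$ vertices; - each part has at most $b$ vertices of $S$ adjacent to it. The division is $c$-strict if $q\le c\,n/r$; the paper calls this ''strict'', meaning $O(n/r)$ components. A temporal walk is a sequence $((v_0,v_1),t_1),\dots,((v_{\ell-1},v_\ell),t_\ell)$ with $\{v_{j-1},v_j\}\in E_{t_j}$ and $t_1<\dots<t_\ell$. Waiting is allowed, and the walk visits $v_0,\dots,v_\ell$. *)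

(* Defs.v *)
From mathcomp Require Import all_boot all_order all_algebra.
From mathcomp Require Import reals exp.

Set Implicit Arguments.
Unset Strict Implicit.
Unset Printing Implicit Defensive.

Import Order.TTheory GRing.Theory Num.Theory.
Local Open Scope ring_scope.

Record sgraph (V : finType) := SGraph {
  adj :> rel V;
  adj_sym : symmetric adj;
  adj_irrefl : irreflexive adj
}.

Definition connected_graph (V : finType) (G : sgraph V) : Prop :=
  forall x y : V, connect G x y.

Definition degree (V : finType) (G : sgraph V) (v : V) : nat :=
  #|[set w | G v w]|.

Definition average_degree (R : realType) (V : finType) (G : sgraph V) : R :=
  (\sum_(v : V) (degree G v)%:R) / #|V|%:R.

(* Snapshots are indexed from 0: [G t] with [t : 'I_T] is the snapshot
   $G_{t+1}$. *)
Definition temporal_graph (V : finType) (T : nat) := 'I_T -> sgraph V.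

Definition always_connected (V : finType) (T : nat)
    (G : temporal_graph V T) : Prop :=
  forall t, connected_graph (G t).

Section Underlying.
Variables (V : finType) (T : nat) (G : temporal_graph V T).

Definition underlying_adj : rel V := fun x y => [exists t : 'I_T, G t x y].

Lemma underlying_adj_sym : symmetric underlying_adj.
Proof. by move=> x y; apply: eq_existsb => t; rewrite adj_sym. Qed.

Lemma underlying_adj_irrefl : irreflexive underlying_adj.
Proof. by move=> x; apply/existsP => -[t]; rewrite adj_irrefl. Qed.

Definition underlying : sgraph V :=
  SGraph underlying_adj_sym underlying_adj_irrefl.

End Underlying.

Definition part_boundary (V : finType) (G : sgraph V) (S A : {set V}) :
    {set V} :=
  [set s in S | [exists v in A, G v s]].

Definition division_parts (R : realType) (V : finType) (G : sgraph V)
    (r b : R) (S : {set V}) (P : {set {set V}}) : Prop :=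
  [/\ partition P (~: S),
      forall x y, G x y ->
        [\/ exists2 A, A \in P & x \in A /\ y \in A,
            x \in S /\ y \in S,
            x \in S /\ (exists2 A, A \in P & y \in A)
          | y \in S /\ (exists2 A, A \in P & x \in A)],
      forall A, A \in P -> #|A|%:R <= r
    & forall A, A \in P -> #|part_boundary G S A|%:R <= b].

Definition strict_division (R : realType) (V : finType) (G : sgraph V)
    (c r b : R) (S : {set V}) : Prop :=
  exists2 P : {set {set V}},
    division_parts G r b S P & #|P|%:R <= c * #|V|%:R / r.

(* A step [((u, v), t)] traverses the edge {u, v} in the snapshot [G t].  The
   start [v0] is explicit, so that the empty walk visits exactly [v0]. *)
Definition temporal_walk (V : finType) (T : nat) (G : temporal_graph V T)
    (v0 : V) (w : seq ((V * V) * 'I_T)) : bool :=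
  [&& [seq e.1.1 | e <- w] == belast v0 [seq e.1.2 | e <- w],
      all (fun e => G e.2 e.1.1 e.1.2) w
    & sorted ltn [seq val e.2 | e <- w]].

Definition visited (V : finType) (T : nat) (v0 : V)
    (w : seq ((V * V) * 'I_T)) : seq V :=
  v0 :: [seq e.1.2 | e <- w].

(* Logarithms are natural; another base changes the value by a constant
   factor only. *)
Definition exploration_bound (R : realType) (n : nat) (r b Delta : R) : R :=
  n%:R * r `^ (1 / 2) * b ^+ 4 * Delta `^ (3 / 2) * ln r `^ (3 / 2) * ln n%:R
  + n%:R ^+ 2 * ln n%:R / r.

(* Main.v *)
Require Import Defs.
From mathcomp Require Import all_boot all_order all_algebra.
From mathcomp Require Import boolp reals sequences exp.
From mathcomp Require Import zify ring lra.

(* Taking [S] to be the whole vertex set gives a strict division of every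
   graph, so the bound has to be proved without the division; indeed every
   always-connected temporal graph is explored in O(n^(4/3) D^(2/3) log n)
   steps, D being the average degree of the underlying graph, and this is O(f)
   for every [r] because (n/r) (r^(1/2) D^(3/2))^2 = n D^3.

   It suffices that every nonempty set [Y] has of the order of (|Y|/D)^(2/3)
   members on one walk of O(n) steps.  Call [v] a contact of [x] in a time
   window if [x] can reach [v] and then return to [x] within the window.  By
   connectivity some edge leaves the current set of contacts at every step, and
   a directed edge can do so only twice, so the contacts of [x] have total
   degree at least half the length of the window.  Hence, if windows are long,
   some vertex is a contact of many members of [Y], and one can walk between
   these in the order of their contact times.

   Suppose that no walk meets more than k^2 members of [Y].  Let the height of a
   vertex at time [t] be the largest number of members of [Y] met from there on,
   and its colour the height divided by k/2, rounded down.  Heights decrease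
   along walks, so that in most windows most members of [Y] keep their colour
   and share it with their contacts.  Counting contacts at a fine time scale
   yields, within a window, disjoint sets of k members of [Y] of one colour,
   each met by one walk.  Counting the contacts of the ends of these walks at a
   coarse scale gives two of them with the same contact and colour such that
   following the first walk by an optimal continuation of the second meets more
   members of [Y] than the colour allows. *)

Set Implicit Arguments.
Unset Strict Implicit.
Unset Printing Implicit Defensive.

(** * Counting and disjoint packings *)

Lemma leq_card_fibers (I : finType) (D : {set I}) (k : I -> nat) (K q : nat) :
  (forall i, i \in D -> k i < K) ->
  (forall n, #|[set i in D | k i == n]| <= q) -> #|D| <= K * q.
Proof.
move=> kK fq; rewrite -sum1_card.
have -> : \sum_(i in D) 1 = \sum_(n < K) \sum_(i in D | k i == n) 1.
  rewrite [LHS](eq_bigr (fun i => \sum_(n < K | k i == n) 1)).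
    by rewrite (exchange_big_dep xpredT).
  by move=> i /kK ki; rewrite (big_pred1 (Ordinal ki)) //.
rewrite -[X in X * _]card_ord -sum_nat_const; apply: leq_sum => n _.
apply: leq_trans (fq n); rewrite -sum1_card; apply/eq_leq/eq_bigl => i.
by rewrite inE.
Qed.

Lemma sum_drops (f : nat -> nat) (N : nat) :
  (forall j, j < N -> f j.+1 <= f j) ->
  \sum_(j < N) (f j != f j.+1) <= f 0 - f N.
Proof.
elim: N => [|N IH] fd; first by rewrite big_ord0.
rewrite big_ord_recr /=.
have IH' := IH (fun j jN => fd j (ltnW jN)).
have := fd N (leqnn _); move: IH'; case: eqP => /= H; last first.
  have : f N <= f 0.
    elim: N fd {IH H} => // N IH fd.
    by apply: leq_trans (fd N _) (IH _) => // j jN; apply: fd; lia.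
  lia.
lia.
Qed.

(** Greedy choice: take one set with [P] out of [Y] and recurse on the rest, which is smaller
    because such sets are nonempty. *)
Lemma maximal_packing (V : finType) (P : {set V} -> Prop) (Y : {set V}) :
  (forall A, P A -> A != set0) ->
  exists F : {set {set V}},
    [/\ trivIset F, forall A : {set V}, A \in F -> P A /\ A \subset Y &
        forall A : {set V}, A \subset Y :\: cover F -> ~ P A].
Proof.
move=> P0; elim: {Y}_.+1 {-2}Y (ltnSn #|Y|) => // n IH Y Yn.
have [[A [AY PA]]|noA] := pselect (exists A : {set V}, A \subset Y /\ P A); last first.
  exists set0; split => [|A|A].
    by apply/trivIsetP => A B; rewrite inE.
    by rewrite inE.
  by rewrite /cover big_set0 setD0 => AY PA; apply: noA; exists A.
have [|F [tF FP Fmax]] := IH (Y :\: A).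
  have := cardsID A Y; rewrite (setIidPr AY).
  by have := P0 _ PA; rewrite -card_gt0; lia.
have dA : [disjoint A & cover F].
  apply/bigcup_disjointP => B /FP[_ /subsetDP[_ dBA]].
  by rewrite disjoint_sym.
have AF : A \notin F.
  apply/negP => AF; have sAF : A \subset cover F by exact: (bigcup_sup A).
  have /negP := P0 _ PA; apply; rewrite -subset0 -(setIid A).
  by apply: (subset_trans (setIS A sAF)); rewrite subset0 setI_eq0.
exists (A |: F); split.
- apply/trivIsetP => B C; rewrite !inE => /orP[/eqP->|BF] /orP[/eqP->|CF];
    rewrite ?eqxx // => BC.
  + by apply: disjointWr dA; apply: bigcup_sup.
  + by rewrite disjoint_sym; apply: disjointWr dA; apply: bigcup_sup.
  + exact: (trivIsetP tF).
- move=> B; rewrite !inE => /orP[/eqP->//|/FP[PB BY]]; split=> //.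
  exact: subset_trans BY (subsetDl _ _).
- move=> B BY; apply: Fmax; apply: subset_trans BY _.
  by rewrite /cover bigcup_setU big_set1 setDDl.
Qed.

(** * Walks, reachability and heights *)

Section Walks.
Variables (V : finType) (g : nat -> rel V).

(** [A] is exactly the set of vertices met. Time runs over all of [nat], and [g t] serves the step
    from [t] to [t.+1]. *)
Inductive walk (s : nat) (x : V) : nat -> V -> {set V} -> Prop :=
| walk_refl : walk s x s x [set x]
| walk_stay t y A : walk s x t y A -> walk s x t.+1 y A
| walk_step t y z A : walk s x t y A -> g t y z -> walk s x t.+1 z (z |: A).

Lemma walk_leq s x t y A : walk s x t y A -> s <= t.
Proof. by elim => // *; apply: leqW. Qed.

Lemma walk_start s x t y A : walk s x t y A -> x \in A.
Proof. by elim => [|//|t' y' z A' _ xA _]; rewrite !inE ?xA ?orbT. Qed.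

Lemma walk_end s x t y A : walk s x t y A -> y \in A.
Proof. by elim => [|//|t' y' z A' _ _ _]; rewrite !inE eqxx. Qed.

Lemma walk_cat s x t y A u z B :
  walk s x t y A -> walk t y u z B -> walk s x u z (A :|: B).
Proof.
move=> W; elim => [|u' z' B' _ IH|u' y' z' B' _ IH gz].
- by have /setUidPl -> : [set y] \subset A by rewrite sub1set (walk_end W).
- exact: walk_stay.
- by rewrite setUCA; apply: walk_step IH gz.
Qed.

Lemma walk_wait s x t : s <= t -> walk s x t x [set x].
Proof.
move/subnKC <-; elim: (t - s) => [|k IH]; first by rewrite addn0; exact: walk_refl.
by rewrite addnS; exact: walk_stay.
Qed.

(** Stop at the last visit to [Z] and wait there: no member of [Z] is lost. *)
Lemma walk_truncate (Z : {set V}) s x t y A :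
  walk s x t y A -> A :&: Z != set0 ->
  exists y' A', [/\ walk s x t y' A', y' \in A' :&: Z & A :&: Z \subset A'].
Proof.
elim => [|t' y' A' _ IH /IH|t' y' z A' W IH gz].
- case/set0Pn => z; rewrite !inE => /andP[/eqP -> xZ].
  exists x, [set x]; split; [exact: walk_refl|by rewrite !inE eqxx|exact: subsetIl].
- by case=> z [B [WB zB AB]]; exists z, B; split => //; apply: walk_stay.
- have [zZ _|zZ] := boolP (z \in Z).
    exists z, (z |: A'); split; [exact: walk_step W gz|by rewrite !inE eqxx|exact: subsetIl].
  have -> : (z |: A') :&: Z = A' :&: Z.
    by apply/setP => u; rewrite !inE; case: eqP => // ->; rewrite (negbTE zZ) !andbF.
  by move/IH => [z' [B [WB zB AB]]]; exists z', B; split => //; apply: walk_stay.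
Qed.

Definition reach s x t y := exists A, walk s x t y A.

Lemma reach_trans s x t y u z : reach s x t y -> reach t y u z -> reach s x u z.
Proof. by move=> [A WA] [B WB]; exists (A :|: B); apply: walk_cat WA WB. Qed.

Lemma reach_wait s x t : s <= t -> reach s x t x.
Proof. by move=> st; exists [set x]; apply: walk_wait. Qed.

Lemma reach_edge s x y : g s x y -> reach s x s.+1 y.
Proof. by move=> gxy; exists (y |: [set x]); apply: walk_step gxy; exact: walk_refl. Qed.

Lemma reach_leq s x t y : reach s x t y -> s <= t.
Proof. by case=> A /walk_leq. Qed.

Definition height (Z : {set V}) (E t : nat) (v : V) : nat :=
  \max_(A : {set V} | `[< exists y, walk t v E y A >]) #|A :&: Z|.

Lemma height_ge Z E t v y A : walk t v E y A -> #|A :&: Z| <= height Z E t v.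
Proof.
by move=> W; rewrite /height (bigmax_sup A) //; apply/asboolP; exists y.
Qed.

Lemma height_witness Z E t v : t <= E ->
  exists y A, walk t v E y A /\ #|A :&: Z| = height Z E t v.
Proof.
move=> tE; have W0 := walk_wait v tE.
have P0 : `[< exists y, walk t v E y [set v] >] by apply/asboolP; exists v.
rewrite /height (bigmax_eq_arg [set v]) //.
by case: arg_maxnP => //= A /asboolP[y W] _; exists y, A.
Qed.

Lemma height_reach Z E s u t v : t <= E -> reach s u t v ->
  height Z E t v <= height Z E s u.
Proof.
move=> tE [B WB]; have [y [A [WA <-]]] := height_witness Z v tE.
apply: leq_trans (height_ge Z (walk_cat WB WA)).
by apply: subset_leq_card; rewrite setSI // subsetUr.
Qed.

Lemma height_wait Z E v s t : t <= E -> s <= t ->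
  height Z E t v <= height Z E s v.
Proof. by move=> tE st; apply: height_reach tE (reach_wait v st). Qed.

Hypothesis gconn : forall t x y, connect (g t) x y.

Lemma exit_edge t (P : {set V}) x : x \in P -> P != setT ->
  exists v u, [/\ v \in P, u \notin P & g t v u].
Proof.
move=> xP PT; have [z zP] : exists z, z \notin P.
  apply/existsP; rewrite -negb_forall; apply: contra PT => /forallP H.
  by apply/eqP/setP => z; rewrite inE H.
have /connectP[p gp zE] := gconn t x z; rewrite {}zE in zP.
elim: p x xP gp zP => [|y p IH] x xP /=; first by rewrite xP.
case/andP => gxy gp zP; have [yP|yP] := boolP (y \in P); first exact: (IH y).
by exists x, y.
Qed.

(** By [exit_edge], the set of vertices reached grows at every step until it is everything. *)
Lemma reach_all s x t y : s + #|V| <= t -> reach s x t y.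
Proof.
move=> st; suff H : forall k, minn #|V| k <= #|[set v | `[< reach s x (s + k) v >]]|.
  have /eqP E : [set v | `[< reach s x (s + #|V|) v >]] == setT.
    by rewrite eqEcard subsetT cardsT (leq_trans _ (H _)) // minnn.
  have : y \in [set v | `[< reach s x (s + #|V|) v >]] by rewrite E.
  by rewrite inE => /asboolP H1; apply: reach_trans H1 (reach_wait y st).
elim => [|k IH]; first by rewrite minn0.
set P := [set v | _] in IH.
have sub : P \subset [set v | `[< reach s x (s + k.+1) v >]].
  apply/subsetP => v; rewrite !inE => /asboolP H; apply/asboolP.
  by apply: reach_trans H (reach_wait v _); rewrite addnS.
have [PT|PT] := eqVneq P setT.
  by apply: leq_trans (subset_leq_card sub); rewrite PT cardsT geq_minl.
have xP : x \in P by rewrite inE; apply/asboolP/reach_wait/leq_addr.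
have [v [u [vP uP gvu]]] := exit_edge (s + k) xP PT.
have : #|P| < #|[set v | `[< reach s x (s + k.+1) v >]]|.
  apply: proper_card; apply/properP; split => //; exists u => //.
  move: vP; rewrite !inE => /asboolP vP; apply/asboolP.
  by apply: reach_trans vP _; rewrite addnS; apply: reach_edge.
lia.
Qed.

(** * Contacts and their double counting *)

Definition contact a x b v tau := reach a x tau v /\ reach tau v b x.

Variables (U : rel V).
Hypothesis gsym : forall t, symmetric (g t).
Hypothesis gU : forall t x y, g t x y -> U x y.

Definition deg v := #|[set u | U v u]|.

(* At each time [t] some edge leaves the set of positions [v] with
   [contact a x b v t].  If a directed edge [(v, u)] did so at three times
   [t1 < t2 < t3], then [u] would be reached after [t1] and could come back
   through [v] by [t3], hence would be in that set at [t2]. *)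
Lemma contact_degree a x b : b - a <= 2 * \sum_v deg v ->
  b - a <= 2 * \sum_(v | `[< exists tau, contact a x b v tau >]) deg v.
Proof.
move=> Lm; pose P t := [set v | `[< contact a x b v t >]].
have PE t v : v \in P t <-> contact a x b v t by rewrite inE; split=> /asboolP.
(* If at one time all vertices are contacts, the sum is the total degree and [Lm] suffices. *)
have [[t PT]|noT] := pselect (exists t, P t = setT).
  apply: leq_trans Lm _; rewrite leq_mul2l /=; apply/eq_leq/esym/eq_bigl => v.
  by apply/asboolP; exists t; apply/PE; rewrite PT inE.
have ex (i : 'I_(b - a)) : exists e : V * V,
    [/\ e.1 \in P (a + i), e.2 \notin P (a + i) & g (a + i) e.1 e.2].
  have [||v [u [vP uP gvu]]] := @exit_edge (a + i) (P (a + i)) x.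
  - by have := ltn_ord i; move=> ?; apply/PE; split; apply: reach_wait; lia.
  - by apply/eqP => PT; apply: noT; exists (a + i).
  by exists (v, u).
have [f fP] := boolp.choice ex.
pose D := [set e : V * V | U e.1 e.2 & `[< exists tau, contact a x b e.1 tau >]].
have -> : \sum_(v | `[< exists tau, contact a x b v tau >]) deg v = #|D|.
  rewrite -sum1_card.
  rewrite (eq_bigr (fun v => \sum_(u | U v u) 1)); last first.
    by move=> v _; rewrite /deg -sum1_card; apply: eq_bigl => u; rewrite inE.
  rewrite pair_big_dep /=; apply: eq_bigl => -[v u]; rewrite !inE /=.
  exact: andbC.
have le2 (e : V * V) : #|[set i | f i == e]| <= 2.
  rewrite leqNgt; apply/negP => /card_gt2P.
  case=> i1 [i2 [i3 [[]]]]; rewrite !inE => /eqP e1 /eqP e2 /eqP e3 [n12 n23 n31].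
  have key (i j k : 'I_(b - a)) : f i = e -> f j = e -> f k = e -> i < j -> j < k -> False.
    move=> ei ej ek ij jk; have [vi _ gi] := fP i; have [_ uj gj] := fP j.
    have [vk _ _] := fP k; rewrite ei in vi gi; rewrite ej in uj gj; rewrite ek in vk.
    case/negP: uj; apply/PE; split.
      have /PE[r1 _] := vi; apply: reach_trans r1 (reach_trans (reach_edge gi) _).
      by apply: reach_wait; lia.
    have /PE[_ r2] := vk; rewrite gsym in gj.
    apply: reach_trans (reach_edge gj) (reach_trans _ r2).
    by apply: reach_wait; lia.
  have [ne1 ne2 ne3] : [/\ i1 <> i2 :> nat, i2 <> i3 :> nat & i3 <> i1 :> nat].
    by split => H; [case/eqP: n12|case/eqP: n23|case/eqP: n31]; apply: val_inj.
  have [h|h] := ltnP i1 i2; have [h'|h'] := ltnP i2 i3; have [h''|h''] := ltnP i1 i3.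
  all: try lia.
  - exact: (key i1 i2 i3).
  - by apply: (key i1 i3 i2) => //; lia.
  - by apply: (key i3 i1 i2) => //; lia.
  - by apply: (key i2 i1 i3) => //; lia.
  - by apply: (key i2 i3 i1) => //; lia.
  - by apply: (key i3 i2 i1) => //; lia.
have -> : 2 * #|D| = \sum_(e in D) 2 by rewrite sum_nat_const mulnC.
rewrite -[X in X <= _](card_ord (b - a)) -sum1_card.
rewrite (partition_big f (mem D)) /=; last first.
  move=> i _; have [vP _ gi] := fP i; rewrite inE (gU gi) /=.
  by apply/asboolP; exists (a + i); apply/PE.
apply: leq_sum => e _; apply: leq_trans (le2 e).
by rewrite -sum1_card; apply/eq_leq/eq_bigl => i; rewrite inE.
Qed.

(** Each [x] in [X i] has contacts of total degree at least [len / 2] by [contact_degree].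
    Conversely, a fixed [v] is a contact for at most [K * q] pairs [(i, x)]: a key value occurs in
    one window only, and there for at most [q] members. *)
Lemma contact_count (N len K q : nat) (a : nat -> nat) (X : nat -> {set V})
    (key : V -> nat -> nat -> nat) :
  len <= 2 * \sum_v deg v ->
  (forall v i x tau, i < N -> x \in X i -> contact (a i) x (a i + len) v tau ->
     key v i tau < K) ->
  (forall v i j x y tau ups, i < N -> j < N -> x \in X i -> y \in X j ->
     contact (a i) x (a i + len) v tau -> contact (a j) y (a j + len) v ups ->
     i < j -> key v i tau <> key v j ups) ->
  (forall v i (D : {set V}) (f : V -> nat) k, i < N -> D \subset X i ->
     (forall x, x \in D -> contact (a i) x (a i + len) v (f x) /\
        key v i (f x) = k) -> #|D| <= q) ->
  len * \sum_(i < N) #|X i| <= 2 * (K * q * \sum_v deg v).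
Proof.
move=> hlen keyK keyI fib.
pose con (i : nat) x v := `[< exists tau, contact (a i) x (a i + len) v tau >].
have step1 : len * \sum_(i < N) #|X i| <=
    \sum_(i < N) \sum_(x in X i) 2 * \sum_(v | con i x v) deg v.
  rewrite big_distrr /=; apply: leq_sum => i _; rewrite mulnC -sum_nat_const.
  apply: leq_sum => x _; have := @contact_degree (a i) x (a i + len).
  by rewrite addKn; apply.
apply: leq_trans step1 _.
have -> : \sum_(i < N) \sum_(x in X i) 2 * \sum_(v | con i x v) deg v =
    2 * \sum_v deg v * #|[set p : 'I_N * V | (p.2 \in X p.1) && con p.1 p.2 v]|.
  rewrite pair_big_dep /= -big_distrr /=; congr (_ * _).
  rewrite (exchange_big_dep xpredT) //=; apply: eq_bigr => v _.
  rewrite mulnC -sum_nat_const; apply: eq_bigl => p; rewrite inE //.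
rewrite leq_mul2l /= mulnC big_distrl /=; apply: leq_sum => v _.
rewrite leq_mul2l; apply/orP; right.
have ex (p : 'I_N * V) : exists t, con p.1 p.2 v ->
    contact (a p.1) p.2 (a p.1 + len) v t.
  have [/asboolP[t ct]|] := boolP (con p.1 p.2 v); first by exists t.
  by exists 0.
have [f fP] := boolp.choice ex.
apply: (@leq_card_fibers _ _ (fun p : 'I_N * V => key v p.1 (f p))).
  by move=> p; rewrite inE => /andP[pX /fP]; apply: keyK.
move=> k; set F := [set i in _ | _].
have [->|[[i x] ixF]] := set_0Vmem F; first by rewrite cards0.
have FE p : p \in F -> [/\ p.1 = i, p.2 \in X i,
    contact (a i) p.2 (a i + len) v (f (i, p.2)) & key v i (f (i, p.2)) = k].
  move: p ixF => [j y]; rewrite !inE /=.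
  move=> /andP[/andP[xX /(fP (i, x)) /= cx] /eqP kx] /andP[/andP[yX /(fP (j, y)) /= cy] /eqP ky].
  have ji : j = i.
    apply: val_inj => /=; have [h|h|//] := ltngtP j i.
      by case: (keyI v j i _ _ _ _ (ltn_ord j) (ltn_ord i) yX xX cy cx h); rewrite kx ky.
    by case: (keyI v i j _ _ _ _ (ltn_ord i) (ltn_ord j) xX yX cx cy h); rewrite kx ky.
  by subst j.
have inj : {in F &, injective snd}.
  by move=> [j y] [j' y'] /FE[/= -> _ _ _] /FE[/= -> _ _ _] ->.
rewrite -(card_in_imset inj).
apply: (fib v i _ (fun y => f (i, y)) k (ltn_ord i)).
  by apply/subsetP => y /imsetP[p /FE[_ pX _ _] ->].
by move=> y /imsetP[p /FE[_ _ c1 c2] ->].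
Qed.

End Walks.

Lemma sum_blocks (F : nat -> nat) (a n : nat) :
  \sum_(i < a * n) F i = \sum_(j < n) \sum_(i < a) F (a * j + i).
Proof.
elim: n => [|n IH]; first by rewrite muln0 !big_ord0.
by rewrite big_ord_recr /= -IH mulnS addnC big_split_ord.
Qed.

Lemma coarse_colour_inj j a b c :
  a <= c -> b <= c -> j + (c - a) = j + (c - b) -> a = b.
Proof. lia. Qed.

(** Digits in base [k]: the last summand stays below [k], so it cannot make up for a change of
    [c - a]. *)
Lemma fine_colour_inj k p a b c d e : a <= c -> b <= c -> d < k -> e < k ->
  p + k * (c - a) + (k.-1 - d) = p + k * (c - b) + (k.-1 - e) -> a = b /\ d = e.
Proof.
move=> ac bc dk ek H; have ab : a = b.
  case: (ltngtP a b) => // ab.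
    have : k * (c - b).+1 <= k * (c - a) by rewrite leq_mul2l; lia.
    lia.
  have : k * (c - a).+1 <= k * (c - b) by rewrite leq_mul2l; lia.
  lia.
by subst b; split=> //; lia.
Qed.

(** Inclusion-exclusion: [n] and [2 * w] are the sizes of two sets, [u] and [i] those of their union
    and intersection. *)
Lemma overlap_ge w c u i h n : u + i = n + 2 * w -> c * w <= n -> u <= h ->
  h < c.+1 * w -> w <= i.
Proof. by rewrite mulSn; lia. Qed.

(** * Contradiction if no walk meets many members of [Y] *)

Section LongWalk.
Variables (V : finType) (g : nat -> rel V) (U : rel V).
Hypothesis gconn : forall t x y, connect (g t) x y.
Hypothesis gsym : forall t, symmetric (g t).
Hypothesis gU : forall t x y, g t x y -> U x y.
Variables (Y : {set V}) (w rho k ell L E : nat).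
Hypothesis w_gt0 : 0 < w.
Hypothesis rho_gt0 : 0 < rho.
Hypothesis Y_gt0 : 0 < #|Y|.
Hypothesis kE : k = 2 * w.
Hypothesis ellE : ell = 28 * k * rho.
Hypothesis LE : L = 4 * k * ell.
Hypothesis EE : E = 2 * L * (4 * k).
Let M := \sum_v deg U v.
Hypothesis M_le : M <= rho * #|Y|.
Hypothesis L_le : L <= 2 * M.
Hypothesis few : forall v y A, walk g 0 v E y A -> #|A :&: Y| <= k ^ 2.

(** Time [[0, E]] splits into [4 * k] windows from [s j] to [s j.+1]. Walks collecting members of
    [Y] are sought before the midpoint [m j], contacts of their ends after it. *)
Let s j := 2 * L * j.
Let m j := s j + L.
Let col t v := height g Y E t v %/ w.

Let sE j : j <= 4 * k -> s j <= E.
Proof. by move=> jk; rewrite EE /s leq_mul2l jk orbT. Qed.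

Let sS j : s j.+1 = m j + L.
Proof. by rewrite /m /s; lia. Qed.

Let mE j : j < 4 * k -> m j <= E.
Proof. by move=> /sE; rewrite sS; lia. Qed.

Let height_le t v : t <= E -> height g Y E t v <= k ^ 2.
Proof.
move=> tE; apply: leq_trans (height_wait g Y v tE (leq0n t)) _.
by have [y [A [W <-]]] := height_witness g Y v (leq0n E); apply: few W.
Qed.

Let col_le t v : t <= E -> col t v <= 2 * k.
Proof.
move=> tE; apply: leq_trans (leq_div2r w (height_le v tE)) _; rewrite kE.
by rewrite (_ : (2 * w) ^ 2 = 2 * (2 * w) * w) ?mulnK //; lia.
Qed.

Let col_reach t u r v : r <= E -> reach g t u r v -> col r v <= col t u.
Proof. by move=> rE H; apply/leq_div2r/height_reach. Qed.

Let col_wait v t r : r <= E -> t <= r -> col r v <= col t v.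
Proof. by move=> rE H; apply/leq_div2r/height_wait. Qed.

Let Yj j := [set x in Y | col (s j) x == col (s j.+1) x].

(** Colours decrease along walks, so that of [v] lies between those of [x] at the two ends of the
    window, which agree. *)
Let Yj_col j x t v r : j < 4 * k -> x \in Yj j ->
  s j <= t -> reach g t x r v -> (exists2 r', r' <= s j.+1 & reach g r v r' x) ->
  col r v = col (s j) x.
Proof.
move=> jk; rewrite inE => /andP[_ /eqP cx] jt xv [r' r'j vx].
have h1 := sE jk; have h2 := reach_leq vx; have h3 := reach_leq xv.
apply/eqP; rewrite eqn_leq; apply/andP; split.
  by apply: col_reach (reach_trans (reach_wait g x jt) xv); lia.
by rewrite cx; apply: col_reach (reach_trans vx (reach_wait g x r'j)).
Qed.

(** A colour starts at [2 * k] or less and only decreases, so it changes in at most half of the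
    [4 * k] windows. *)
Let sum_Yj : 2 * k * #|Y| <= \sum_(j < 4 * k) #|Yj j|.
Proof.
have H : \sum_(j < 4 * k) #|Y :\: Yj j| <= 2 * k * #|Y|.
  under eq_bigr => j _.
    rewrite -sum1_card (eq_bigl (fun x => (x \in Y) && (col (s j) x != col (s j.+1) x))).
      rewrite big_mkcondr /=. over.
    by move=> x; rewrite !inE; case: (x \in Y); rewrite ?andbT ?andbF.
  rewrite exchange_big /= [leqRHS]mulnC -sum_nat_const; apply: leq_sum => x _.
  apply: (@leq_trans (\sum_(j < 4 * k) (col (s j) x != col (s j.+1) x))).
    by apply: leq_sum => j _; case: (_ != _).
  apply: leq_trans (@sum_drops (fun j => col (s j) x) (4 * k) _) _ => [j jk|].
    by apply: col_wait; [exact: sE|rewrite leq_mul2l leqnSn orbT].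
  by apply: leq_trans (leq_subr _ _) _; apply: col_le; rewrite /s muln0.
have : \sum_(j < 4 * k) #|Y :\: Yj j| + \sum_(j < 4 * k) #|Yj j| = 4 * k * #|Y|.
  have -> : 4 * k * #|Y| = \sum_(j < 4 * k) #|Y| by rewrite sum_nat_const card_ord.
  rewrite -big_split /=.
  apply: eq_bigr => j _; rewrite -(cardsID (Yj j) Y) addnC; congr (_ + _).
  by rewrite (setIidPr _) //; apply/subsetP => x; rewrite inE => /andP[].
lia.
Qed.

(** The walk has to end inside [A], since its end [xs] will represent [A] in the coarse count. *)
Let chain_from j (A : {set V}) x xs :=
  [/\ x \in Yj j, xs \in A, forall a, a \in A -> col (s j) a = col (s j) x &
      exists2 B, walk g (s j) x (m j) xs B & A \subset B].

Let chain j (A : {set V}) := #|A| = k /\ exists x xs, chain_from j A x xs.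

(** * Fine scale: a maximal packing by chains leaves few members over *)

Section Packing.
Variable fam : nat -> {set {set V}}.
Hypothesis fam_triv : forall j, trivIset (fam j).
Hypothesis fam_chain : forall j (A : {set V}), A \in fam j -> chain j A /\ A \subset Yj j.
Hypothesis fam_max : forall j (A : {set V}), A \subset Yj j :\: cover (fam j) -> ~ chain j A.

Let Z j := Yj j :\: cover (fam j).
Let Zc j c := [set x in Z j | col (s j) x == c].
Let eta j c t v := height g (Zc j c) (m j) t v.

(** Otherwise a walk meeting [k] leftover members of colour [c], cut off at its last one, gives a
    chain disjoint from the packing, against maximality. *)
Let eta_lt j c x : x \in Zc j c -> eta j c (s j) x < k.
Proof.
move=> xZ; rewrite ltnNge; apply/negP => kle.
have sm : s j <= m j by exact: leq_addr.
have [y [A [W Ah]]] := height_witness g (Zc j c) x sm.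
rewrite -/(eta j c (s j) x) in Ah.
have AZ : A :&: Zc j c != set0.
  by apply/set0Pn; exists x; rewrite inE xZ (walk_start W).
have [xs [B [WB xsB AB]]] := walk_truncate W AZ.
have : k <= #|B :&: Zc j c|.
  apply: leq_trans kle _; rewrite -Ah; apply: subset_leq_card.
  by rewrite subsetI AB subsetIr.
have [C [CB xsC Ck]] : exists C : {set V}, [/\ C \subset B :&: Zc j c, xs \in C & #|C| = minn k #|B :&: Zc j c|].
  have k0 : 0 < k by rewrite kE muln_gt0.
  (* The end [xs] is set aside first, so that the [k] members selected include it. *)
  pose D := (B :&: Zc j c) :\ xs.
  have cD := cardsD1 xs (B :&: Zc j c); rewrite xsB -/D in cD.
  pose C := [set:: take k.-1 (enum D)].
  have uC : uniq (take k.-1 (enum D)) by rewrite take_uniq ?enum_uniq.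
  have CD : C \subset D.
    by apply/subsetP => z; rewrite inE => /mem_take; rewrite mem_enum.
  exists (xs |: C); split.
  - rewrite subUset sub1set xsB /=; apply: subset_trans CD _; exact: subsetDl.
  - by rewrite !inE eqxx.
  rewrite cardsU1; have -> : xs \notin C.
    by apply/negP => /(subsetP CD); rewrite !inE eqxx.
  rewrite /C cardsE (card_uniqP uC) size_take -cardE; case: ltnP; lia.
move/minn_idPl => kk; rewrite kk in Ck.
have CZ : C \subset Zc j c by apply: subset_trans CB (subsetIr _ _).
apply: (@fam_max j C); first by apply: subset_trans CZ _; apply/subsetP => z; rewrite inE => /andP[].
split=> //; exists x, xs; split => //.
- by move: xZ; rewrite !inE => /andP[/andP[_ ->]].
- by move=> a /(subsetP CZ); move: xZ; rewrite !inE => /andP[_ /eqP->] /andP[_ /eqP->].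
- by exists B => //; apply: subset_trans CB (subsetIl _ _).
Qed.

(** As [N * ell = E], these fine windows fill [[0, E]], and [jo i] is the outer window around the
    [i]-th. Those in second halves get the empty set, because [eta] only looks ahead to [m j]. *)
Let N := 2 * (4 * k) * (4 * k).
Let jo i := i %/ (2 * (4 * k)).
Let X i := if i %% (2 * (4 * k)) < 4 * k then
  [set x in Z (jo i) | eta (jo i) (col (s (jo i)) x) (i * ell) x ==
                       eta (jo i) (col (s (jo i)) x) (i * ell + ell) x]
  else set0.

Let k_gt0 : 0 < k. Proof. by rewrite kE muln_gt0. Qed.

Let jo_lt i : i < N -> jo i < 4 * k.
Proof. by move=> iN; rewrite /jo ltn_divLR ?muln_gt0 ?k_gt0 // mulnC. Qed.

(** Colour and [eta] decrease from [x] through [v] back to [x] and are the same before and after,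
    hence also at [v]. *)
Let fine_contact i x v tau : i < N -> x \in X i -> contact g (i * ell) x (i * ell + ell) v tau ->
  [/\ s (jo i) <= i * ell, i * ell + ell <= m (jo i), i * ell <= tau <= i * ell + ell,
      x \in Zc (jo i) (col tau v) & col tau v <= 2 * k] /\
  [/\ eta (jo i) (col tau v) (i * ell) x = eta (jo i) (col tau v) tau v,
      eta (jo i) (col tau v) (i * ell + ell) x = eta (jo i) (col tau v) tau v &
      eta (jo i) (col tau v) tau v < k].
Proof.
move=> iN; have jk := jo_lt iN; rewrite /X; case: ltnP => [im|]; last by rewrite inE.
move=> xX [xv vx].
have iE := divn_eq i (2 * (4 * k)); rewrite -/(jo i) in iE.
have h1 : s (jo i) <= i * ell by rewrite /s LE [X in _ <= X * _]iE; lia.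
have h2 : i * ell + ell <= m (jo i).
  rewrite /m /s -mulSnr LE.
  apply: (@leq_trans ((jo i * (2 * (4 * k)) + 4 * k) * ell)).
    by rewrite leq_mul2r; apply/orP; right; lia.
  lia.
have h3 : i * ell <= tau <= i * ell + ell by rewrite (reach_leq xv) (reach_leq vx).
have mSE : m (jo i) <= s (jo i).+1 by rewrite sS leq_addr.
have xZ : x \in Z (jo i) by move: xX; rewrite inE => /andP[].
have xY : x \in Yj (jo i) by move: xZ; rewrite inE => /andP[].
have cE : col tau v = col (s (jo i)) x.
  by apply: Yj_col jk xY h1 xv _; exists (i * ell + ell) => //; lia.
have xZc : x \in Zc (jo i) (col tau v) by rewrite inE xZ cE eqxx.
move: xX; rewrite inE xZ /= -cE => /eqP e1.
have mE' := mE jk.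
have e2 : eta (jo i) (col tau v) tau v <= eta (jo i) (col tau v) (i * ell) x.
  by apply: height_reach xv; lia.
have e3 : eta (jo i) (col tau v) (i * ell + ell) x <= eta (jo i) (col tau v) tau v.
  by apply: height_reach vx; lia.
have e4 := eta_lt xZc.
have e5 : eta (jo i) (col tau v) (i * ell) x <= eta (jo i) (col tau v) (s (jo i)) x.
  by apply: height_wait; lia.
have c1 : col tau v <= 2 * k by apply: col_le; lia.
by split; split=> //; lia.
Qed.

(* Along the contact times of a fixed [v], the window index [i] increases, the
   colour decreases, and [eta] decreases as long as [jo i] and the colour do not
   change; as [eta < k], the key determines all of them. *)
Let fine_key v i tau := i + k * jo i + k * (2 * k - col tau v) +
  (k.-1 - eta (jo i) (col tau v) tau v).

Let fine_key_lt v i x tau : i < N -> x \in X i -> contact g (i * ell) x (i * ell + ell) v tau ->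
  fine_key v i tau < 39 * k ^ 2.
Proof.
move=> iN xX ct; have [[_ _ _ _ cm] [_ _ em]] := fine_contact iN xX ct.
have jk := jo_lt iN; rewrite /fine_key.
(* Here [i < N = 32 * k ^ 2], and the other summands contribute at most 4, 2 and 1 times [k ^ 2]. *)
have h1 : k * jo i <= k * (4 * k) by rewrite leq_mul2l; lia.
have h2 : k * (2 * k - col tau v) <= k * (2 * k) by rewrite leq_mul2l; lia.
have h3 : k <= k ^ 2 by rewrite -{1}(expn1 k) leq_pexp2l.
by move: iN; rewrite /N; lia.
Qed.

Let fine_key_neq v i j x y tau ups : i < N -> j < N -> x \in X i -> y \in X j ->
  contact g (i * ell) x (i * ell + ell) v tau ->
  contact g (j * ell) y (j * ell + ell) v ups -> i < j -> fine_key v i tau <> fine_key v j ups.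
Proof.
move=> iN jN xX yX cx cy ij.
have [[_ _ /andP[_ ti] _ ci] [_ _ ei]] := fine_contact iN xX cx.
have [[_ jm /andP[uj uj'] _ cj] [_ _ ej]] := fine_contact jN yX cy.
have tu : tau <= ups.
  by apply: leq_trans ti (leq_trans _ uj); rewrite -mulSnr leq_mul2r ij orbT.
have uE : ups <= m (jo j) by lia.
have cc : col ups v <= col tau v.
  by apply: col_wait tu; have := mE (jo_lt jN); lia.
have jj : jo i <= jo j by apply: leq_div2r; exact: ltnW.
have kj : k * jo i <= k * jo j by rewrite leq_mul2l jj orbT.
have kc : k * (2 * k - col tau v) <= k * (2 * k - col ups v) by rewrite leq_mul2l; lia.
rewrite /fine_key; have [jE|jN'] := eqVneq (jo i) (jo j); last first.
  have : k * (jo i).+1 <= k * jo j by rewrite leq_mul2l; lia.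
  lia.
have [cE|cN'] := eqVneq (col tau v) (col ups v); last first.
  have : k * (2 * k - col tau v).+1 <= k * (2 * k - col ups v) by rewrite leq_mul2l; lia.
  lia.
have : eta (jo j) (col ups v) ups v <= eta (jo i) (col tau v) tau v.
  by rewrite jE cE; apply: height_wait.
lia.
Qed.

(** Let [z] have the latest contact time and [S] be an optimal continuation from [z]. Each [x] in
    [D] can go to [v], wait, go to [z] and follow [S]. Since [x] and [z] have equal [eta], this
    meets nothing beyond [S] in the leftover class, so [x] is in [S]; and [S] meets fewer than [k]
    of that class. *)
Let fine_fibre v i (D : {set V}) (f : V -> nat) n : i < N -> D \subset X i ->
  (forall x, x \in D -> contact g (i * ell) x (i * ell + ell) v (f x) /\
     fine_key v i (f x) = n) -> #|D| <= k.
Proof.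
move=> iN DX HD; have [->|[x0 x0D]] := set_0Vmem D; first by rewrite cards0.
have [z zD zmax] := arg_maxnP f x0D.
have [cz kz] := HD z zD; have zX := subsetP DX _ zD.
have [[a1 a2 /andP[a3 a3'] a4 a5] [b1 b2 b3]] := fine_contact iN zX cz.
set c := col (f z) v in a4 a5 b1 b2 b3.
have [y [S [WS Sh]]] := height_witness g (Zc (jo i) c) z a2.
rewrite -/(eta _ _ _ _) b2 in Sh.
suff DS : D \subset S :&: Zc (jo i) c.
  by apply: leq_trans (subset_leq_card DS) _; rewrite Sh ltnW.
apply/subsetP => x xD; have [cx kx] := HD x xD; have xX := subsetP DX _ xD.
have [[_ _ /andP[d3 d3'] d4 d5] [e1 e2 e3]] := fine_contact iN xX cx.
have fxz : f x <= f z by exact: zmax.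
have [cE etaE] := fine_colour_inj d5 a5 e3 b3 (etrans kx (esym kz)).
rewrite -/c in cE; rewrite cE in d4 e1 e2 e3 etaE.
have [[B WB] _] := cx; have [_ [B' WB']] := cz.
have W := walk_cat (walk_cat WB (walk_wait g v fxz)) (walk_cat WB' WS).
have := height_ge (Zc (jo i) c) W; rewrite -/(eta _ _ _ _) e1 etaE -Sh => hle.
have SR : S :&: Zc (jo i) c \subset (B :|: [set v] :|: (B' :|: S)) :&: Zc (jo i) c.
  by rewrite setSI // setUA subsetUr.
have /eqP -> : S :&: Zc (jo i) c == (B :|: [set v] :|: (B' :|: S)) :&: Zc (jo i) c.
  by rewrite eqEcard SR.
by rewrite inE d4 !inE (walk_start WB).
Qed.

(** For each leftover member [eta] drops fewer than [k] times, so it lies in [X i] for at least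
    [3 * k] fine windows. Then [contact_count] gives the bound, the factor 28 in [ell] making
    [28 * 3 = 84] exceed [2 * 39 = 78]. *)
Let sum_Z : \sum_(j < 4 * k) #|Z j| <= k * #|Y|.
Proof.
have ellL : ell <= 2 * M.
  apply: leq_trans L_le; rewrite LE -{1}(mul1n ell) leq_mul2r; apply/orP; right; lia.
have := contact_count gconn gsym gU ellL fine_key_lt fine_key_neq fine_fibre.
have : 3 * k * \sum_(j < 4 * k) #|Z j| <= \sum_(i < N) #|X i|.
  rewrite /N big_distrr /=.
  have -> : \sum_(i < 2 * (4 * k) * (4 * k)) #|X i| =
     \sum_(j < 4 * k) \sum_(i < 2 * (4 * k)) #|X (2 * (4 * k) * j + i)|.
    exact: (sum_blocks (fun i => #|X i|)).
  apply: leq_sum => j _; set K := 4 * k.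
  rewrite mul2n -addnn big_split_ord /=; apply: leq_trans (leq_addr _ _).
  have iE (i : 'I_K) : X ((K + K) * j + i) =
      [set x in Z j | eta j (col (s j) x) (s j + i * ell) x ==
                      eta j (col (s j) x) (s j + i.+1 * ell) x].
    have iK := ltn_ord i.
    have d0 : 0 < K + K by lia.
    rewrite /X /jo -/K mul2n -addnn mulnC modnMDl divnMDl // divn_small ?addn0; last lia.
    rewrite modn_small; last lia.
    rewrite iK; have -> : (j * (K + K) + i) * ell = s j + i * ell by rewrite /s LE -/K; lia.
    by rewrite -addnA -mulSnr.
  under [leqRHS]eq_bigr => i _ do rewrite iE.
  have H : \sum_(i < K) #|Z j :\: [set x in Z j | eta j (col (s j) x) (s j + i * ell) x ==
                      eta j (col (s j) x) (s j + i.+1 * ell) x]| <= k * #|Z j|.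
    under eq_bigr => i _.
      rewrite -sum1_card (eq_bigl (fun x => (x \in Z j) &&
        (eta j (col (s j) x) (s j + i * ell) x != eta j (col (s j) x) (s j + i.+1 * ell) x))).
        rewrite big_mkcondr /=. over.
      by move=> x; rewrite inE [in X in X = _]inE; case: (x \in Z j); rewrite ?andbT ?andbF.
    rewrite exchange_big /= [leqRHS]mulnC -sum_nat_const; apply: leq_sum => x xZ.
    set c := col (s j) x.
    apply: (@leq_trans (\sum_(i < K) (eta j c (s j + i * ell) x != eta j c (s j + i.+1 * ell) x))).
      by apply: leq_sum => i _; case: (_ != _).
    apply: leq_trans (@sum_drops (fun i => eta j c (s j + i * ell) x) K _) _ => [i iK|].
      apply: height_wait; last by rewrite leq_add2l leq_mul2r leqnSn orbT.
      by rewrite /m leq_add2l LE leq_mul2r iK orbT.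
    apply: leq_trans (leq_subr _ _) _; rewrite mul0n addn0 ltnW //; apply: eta_lt.
    by rewrite inE xZ eqxx.
  move: H; set SX := \sum_(i < K) #|[set x in Z j | _]|; set SD := \sum_(i < K) _ => H.
  have : SD + SX = K * #|Z j|.
    have -> : K * #|Z j| = \sum_(i < K) #|Z j| by rewrite sum_nat_const card_ord.
    rewrite /SD /SX -big_split /=.
    apply: eq_bigr => i _; set XX := [set x in Z j | _]; rewrite -(cardsID XX (Z j)) addnC.
    congr (_ + _); rewrite (setIidPr _) //; apply/subsetP => x.
    by rewrite inE => /andP[].
  by rewrite /K; lia.
rewrite -/M; set SX := \sum_(i < N) _; set SZ := \sum_(j < _) _ => H1 H2.
have H3 : 84 * rho * k ^ 2 * SZ <= 78 * k ^ 3 * (rho * #|Y|).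
  apply: (@leq_trans (2 * (39 * k ^ 2 * k * M))).
    apply: leq_trans H2.
    apply: (@leq_trans (ell * (3 * k * SZ))); first by rewrite ellE; lia.
    by rewrite leq_mul2l H1 orbT.
  apply: (@leq_trans (78 * k ^ 3 * M)); first lia.
  by rewrite leq_mul2l M_le orbT.
have p0 : 0 < 78 * rho * k ^ 2 by rewrite !muln_gt0 rho_gt0 k_gt0.
rewrite -(leq_pmul2l p0).
apply: (@leq_trans (84 * rho * k ^ 2 * SZ)); first by rewrite !leq_mul2r /= !orbT.
apply: leq_trans H3 _; lia.
Qed.

(** * Coarse scale: contacts of the ends of chains *)

Let ends (e : nat * {set V} -> V) j := [set e (j, A) | A in fam j].
(** Along the contact times of [v] the index [j] grows and the colour falls, so keys differ between
    windows and determine the colour within one. *)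
Let coarse_key v j tau := j + (2 * k - col tau v).

Section Ends.
Variable e : nat * {set V} -> V.
Hypothesis eP : forall p, p.2 \in fam p.1 -> exists x, chain_from p.1 p.2 x (e p).

Let coarse_contact j x v tau : j < 4 * k -> x \in ends e j -> contact g (m j) x (m j + L) v tau ->
  [/\ m j <= tau <= s j.+1, tau <= E, pblock (fam j) x \in fam j,
      x = e (j, pblock (fam j) x) & x \in Yj j /\ col tau v = col (s j) x].
Proof.
move=> jk /imsetP[A AF {x}->] [xv vx]; set x := e (j, A) in xv vx *.
have [x0 [_ xA _ _]] := eP (p := (j, A)) AF.
have pE := def_pblock (fam_triv j) AF xA; rewrite -/x in pE.
have [_ AY] := fam_chain AF; have xY := subsetP AY _ xA.
rewrite -/x in xY; rewrite -sS in vx.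
have h1 := reach_leq xv; have h2 := reach_leq vx; have h3 := sE jk.
rewrite pE; split => //; [by rewrite h1|lia|split=> //].
apply: Yj_col jk xY _ xv _; first exact: leq_addr.
by exists (s j.+1).
Qed.

Let coarse_key_lt v j x tau : j < 4 * k -> x \in ends e j -> contact g (m j) x (m j + L) v tau ->
  coarse_key v j tau < 7 * k.
Proof. by move=> jk _ _; rewrite /coarse_key; lia. Qed.

Let coarse_key_neq v i j x y tau ups : i < 4 * k -> j < 4 * k -> x \in ends e i -> y \in ends e j ->
  contact g (m i) x (m i + L) v tau -> contact g (m j) y (m j + L) v ups ->
  i < j -> coarse_key v i tau <> coarse_key v j ups.
Proof.
move=> ik jk xX yX cx cy ij.
have [/andP[_ ti] _ _ _ _] := coarse_contact ik xX cx.
have [/andP[uj _] uE _ _ _] := coarse_contact jk yX cy.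
have sij : s i.+1 <= s j by rewrite /s leq_mul2l ij orbT.
have mj : s j <= m j by exact: leq_addr.
have : col ups v <= col tau v by apply: col_wait => //; lia.
by rewrite /coarse_key; lia.
Qed.

(** Let [z] have the latest contact time and let [S'] be what an optimal continuation from [z] meets
    of [Y]. Following the chain [A] of [x], then [v], [z] and that continuation, meets [A] and [S'].
    By the common colour the union has fewer than [c.+1 * w] members, so [A] shares at least [w]
    with [S']. The chains are disjoint and [S'] has at most [4 * w ^ 2] members. *)
Let coarse_fibre v j (D : {set V}) (f : V -> nat) n : j < 4 * k -> D \subset ends e j ->
  (forall x, x \in D -> contact g (m j) x (m j + L) v (f x) /\
     coarse_key v j (f x) = n) -> #|D| <= 2 * k.
Proof.
move=> jk DX HD; have [->|[x0 x0D]] := set_0Vmem D; first by rewrite cards0.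
have [z zD zmax] := arg_maxnP f x0D.
have [cz kz] := HD z zD; have zX := subsetP DX _ zD.
have [_ fzE _ _ [zY colz]] := coarse_contact jk zX cz.
set c := col (f z) v in colz.
have [y [S [WS Sh]]] := height_witness g Y z (sE jk).
set S' := S :&: Y in Sh.
have cS : c * w <= #|S'|.
  rewrite Sh; suff -> : c = col (s j.+1) z by apply: leq_divM.
  by rewrite colz; move: zY; rewrite inE => /andP[_ /eqP].
have big x : x \in D -> w <= #|S' :&: pblock (fam j) x|.
  move=> xD; have [cx kx] := HD x xD; have xX := subsetP DX _ xD.
  have [_ fxE AF xE [_ colx]] := coarse_contact jk xX cx.
  set A := pblock (fam j) x in AF xE *.
  have [x' [x'Y xA colA [B WB AB]]] := eP (p := (j, A)) AF.
  rewrite /= -xE in x'Y xA colA WB AB.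
  have [[Ak _] AY] := fam_chain AF.
  have fxz : f x <= f z by exact: zmax.
  have cxc : col (f x) v = c.
    exact: coarse_colour_inj (col_le v fxE) (col_le v fzE) (etrans kx (esym kz)).
  have [[B1 W1] _] := cx; have [_ [B2 W2]] := cz; rewrite -sS in W2.
  have W := walk_cat WB (walk_cat (walk_cat W1 (walk_wait g v fxz)) (walk_cat W2 WS)).
  have H1 := height_ge Y W.
  have AY' : A \subset Y.
    by apply: subset_trans AY _; apply/subsetP => a; rewrite inE => /andP[].
  have H2 : #|S' :|: A| <= height g Y E (s j) x'.
    apply: leq_trans H1; apply: subset_leq_card.
    rewrite subUset !subsetI AY' subsetIr !andbT; apply/andP; split.
      by apply: subset_trans (subsetIl _ _) _; rewrite !setUA subsetUr.
    by apply: subset_trans AB _; apply: subsetUl.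
  have H3 : height g Y E (s j) x' < c.+1 * w.
    rewrite -cxc colx (colA _ xA); exact: ltn_ceil.
  by apply: overlap_ge cS H2 H3; rewrite cardsUI Ak kE.
have cnt : #|D| * w <= #|S'|.
  rewrite -sum_nat_const.
  apply: (@leq_trans (\sum_(x in D) \sum_(a in S' | a \in pblock (fam j) x) 1)).
    apply: leq_sum => x xD; apply: leq_trans (big x xD) _.
    by rewrite -sum1_card; apply/eq_leq/eq_bigl => a; rewrite inE.
  rewrite (exchange_big_dep (mem S')) /=; last by move=> x a _ /andP[].
  rewrite -[leqRHS]sum1_card; apply: leq_sum => a aS.
  rewrite sum1dep_card -[X in X <= _]cardsE; apply/card_le1_eqP => x x'.
  have pbE u : u \in D -> a \in pblock (fam j) u -> u = e (j, pblock (fam j) a).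
    move=> uD au; have [cu _] := HD u uD.
    have [_ _ AF uE _] := coarse_contact jk (subsetP DX _ uD) cu.
    by rewrite (def_pblock (fam_triv j) AF au).
  rewrite !inE => /andP[xD /andP[_ ax]] /andP[xD' /andP[_ ax']].
  by rewrite (pbE _ xD ax) (pbE _ xD' ax').
rewrite -(leq_pmul2r w_gt0); apply: leq_trans cnt _; rewrite Sh.
by apply: leq_trans (height_le z (sE jk)) _; rewrite kE; lia.
Qed.

(** By [sum_Yj] and [sum_Z] the chains cover at least [k * #|Y|] members in total, so there are at
    least [#|Y|] ends. Counting their contacts yields [L <= 28 * k ^ 2 * rho], while
    [L = 112 * k ^ 2 * rho]. *)
Lemma absurd_ends : False.
Proof.
have := contact_count gconn gsym gU L_le coarse_key_lt coarse_key_neq coarse_fibre.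
rewrite -/M => H.
have cX (j : 'I_(4 * k)) : #|ends e j| = #|fam j|.
  apply: card_in_imset => A B AF BF eAB.
  have [_ [_ eA _ _]] := eP (p := (val j, A)) AF.
  have [_ [_ eB _ _]] := eP (p := (val j, B)) BF.
  by rewrite -(def_pblock (fam_triv j) AF eA) eAB (def_pblock (fam_triv j) BF eB).
have cY (j : 'I_(4 * k)) : #|Yj j| = k * #|ends e j| + #|Z j|.
  rewrite -(cardsID (cover (fam j)) (Yj j)); congr (_ + _).
  have /setIidPr -> : cover (fam j) \subset Yj j.
    by apply/bigcupsP => A /fam_chain[].
  rewrite cX; have /eqP <- := fam_triv j.
  by rewrite [RHS]mulnC -sum_nat_const; apply: eq_bigr => A /fam_chain[[]].
have := sum_Yj; rewrite (eq_bigr _ (fun j _ => cY j)) big_split /= -big_distrr /=.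
move: H; set SX := \sum_(j < _) #|ends e j|; set SZ := \sum_(j < _) #|Z j| => H HY.
have HZ : SZ <= k * #|Y| by exact: sum_Z.
have {HY HZ} HX : #|Y| <= SX.
  by rewrite -(leq_pmul2l k_gt0); lia.
have H1 : L * #|Y| <= 28 * k ^ 2 * (rho * #|Y|).
  apply: (@leq_trans (L * SX)); first by rewrite leq_mul2l HX orbT.
  apply: leq_trans H _; apply: (@leq_trans (28 * k ^ 2 * M)); first lia.
  by rewrite leq_mul2l M_le orbT.
have p0 : 0 < k * k * rho * #|Y| by rewrite !muln_gt0 k_gt0 rho_gt0 Y_gt0.
by move: H1; rewrite LE ellE; lia.
Qed.

End Ends.

Lemma absurd_packing : False.
Proof.
have ex (p : nat * {set V}) : exists xs, p.2 \in fam p.1 ->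
    exists x, chain_from p.1 p.2 x xs.
  have [|nF] := boolP (p.2 \in fam p.1).
    by move=> /fam_chain[[_ [x [xs H]]] _]; exists xs => _; exists x.
  (* Outside [fam] an arbitrary value will do. *)
  have [x _] : exists x, x \in Y by apply/set0Pn; rewrite -card_gt0.
  by exists x.
by have [e eP] := boolp.choice ex; exact: absurd_ends eP.
Qed.

End Packing.

Lemma no_long_walk_absurd : False.
Proof.
have [j|fam famP] := boolp.choice (fun j => maximal_packing (P := chain j) (Yj j) _).
  move=> A [Ak _]; rewrite -card_gt0 Ak kE muln_gt0; exact: w_gt0.
apply: (@absurd_packing fam) => j; by have [] := famP j.
Qed.

End LongWalk.

(** * Exploration in phases of length [17 * #|V|] *)

Lemma walk_shift (V : finType) (g : nat -> rel V) s x t y A :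
  walk (fun u => g (s + u)) 0 x t y A -> walk g s x (s + t) y A.
Proof.
elim=> [|u z B _ IH|u z z' B _ IH gz]; rewrite ?addn0 ?addnS.
- exact: walk_refl.
- exact: walk_stay.
- exact: walk_step IH gz.
Qed.

Section Exploration.
Variables (V : finType) (g : nat -> rel V) (U : rel V).
Hypothesis gconn : forall t x y, connect (g t) x y.
Hypothesis gsym : forall t, symmetric (g t).
Hypothesis gU : forall t x y, g t x y -> U x y.
Let M := \sum_v deg U v.

(** With [k = 2 * w], the lengths of the section above are [L = 448 * w ^ 2 * rho] and
    [E = 16 * w * L]. *)
Lemma long_walk (Y : {set V}) (w rho s : nat) :
  0 < w -> 0 < rho -> 0 < #|Y| -> M <= rho * #|Y| -> 448 * w ^ 2 * rho <= 2 * M ->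
  exists v y A, walk g s v (s + 16 * (448 * w ^ 3 * rho)) y A /\ 4 * w ^ 2 < #|A :&: Y|.
Proof.
move=> w0 r0 Y0 MY wM; apply: contrapT => no.
apply: (@no_long_walk_absurd V (fun t => g (s + t)) U (fun t => gconn _) (fun t => gsym _)
  (fun t => gU (t := s + t)) Y w rho _ _ _ _ w0 r0 Y0 erefl erefl erefl erefl MY).
- by apply: leq_trans wM; lia.
- move=> v y A W; rewrite leqNgt; apply/negP => big; apply: no.
  exists v, y, A; split; last by rewrite (expnMn 2 w 2) in big.
  have -> : 16 * (448 * w ^ 3 * rho) =
      2 * (4 * (2 * w) * (28 * (2 * w) * rho)) * (4 * (2 * w)) by lia.
  exact: walk_shift W.
Qed.

Hypothesis V_gt1 : 1 < #|V|.

Lemma card_le_degrees : #|V| <= M.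
Proof.
rewrite -cardsT -sum1_card /M big_mkcond /=; apply: leq_sum => v _; rewrite inE.
have vT : [set v] != setT :> {set V}.
  by apply/eqP => H; have := cards1 v; rewrite H cardsT; lia.
have [_ [u [/set1P -> _ /gU Uvu]]] := exit_edge gconn 0 (set11 v) vT.
by rewrite /deg card_gt0; apply/set0Pn; exists u; rewrite inE.
Qed.

(** Take [w] maximal such that the walk of [long_walk] fits into [16 * #|V|] steps; [#|V|] more lead
    to its start. Maximality gives the last inequality. *)
Lemma exploration_phase (Y : {set V}) v s : 0 < #|Y| ->
  exists y A w, [/\ walk g s v (s + 17 * #|V|) y A, w.+1 ^ 2 <= #|A :&: Y| &
    #|V| * #|Y| < 896 * M * w.+1 ^ 3].
Proof.
move=> Y0; set n := #|V|; pose rho := (M %/ #|Y|).+1.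
have nM : n <= M := card_le_degrees.
have YV : #|Y| <= n := max_card _.
have MY : M <= rho * #|Y| by rewrite ltnW // ltn_ceil.
have rY : rho * #|Y| <= 2 * M.
  by rewrite /rho mulSn mul2n -addnn leq_add ?leq_divM ?(leq_trans YV).
pose P w := 448 * w ^ 3 * rho <= n.
have P0 : exists w, P w by exists 0; rewrite /P.
have Pb w : P w -> w <= n.
  move=> Pw; apply: leq_trans Pw; case: w => // w.
  apply: (@leq_trans (w.+1 ^ 3)); last by rewrite mulnAC leq_pmull.
  by rewrite -{1}(expn1 w.+1) leq_pexp2l.
have [w Pw wmax] := ex_maxnP P0 Pb.
have wS : n < 448 * w.+1 ^ 3 * rho.
  by rewrite ltnNge; apply/negP => /wmax; rewrite ltnn.
have est : n * #|Y| < 896 * M * w.+1 ^ 3.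
  apply: (@leq_trans (448 * w.+1 ^ 3 * rho * #|Y|)); first by rewrite ltn_pmul2r.
  rewrite -mulnA; apply: (@leq_trans (448 * w.+1 ^ 3 * (2 * M))).
    by rewrite leq_mul2l rY orbT.
  lia.
(* For [w = 0], walking to a single member of [Y] is enough. *)
have [w0|w0] := posnP w.
  have [y yY] : exists y, y \in Y by apply/set0Pn; rewrite -card_gt0.
  have [A W] : reach g s v (s + 17 * n) y by apply: reach_all => //; rewrite -/n; lia.
  exists y, A, w; split=> //; rewrite w0 exp1n card_gt0; apply/set0Pn; exists y.
  by rewrite inE yY (walk_end W).
have [|v' [y [A [W big]]]] := @long_walk Y w rho (s + n) w0 isT Y0 MY.
  apply: (@leq_trans M); last by rewrite leq_pmull.
  by apply: leq_trans nM; apply: leq_trans Pw; rewrite leq_mul2r leq_mul2l leq_pexp2l ?orbT.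
have [B WB] : reach g s v (s + n) v' by apply: reach_all.
have tE : s + n + 16 * (448 * w ^ 3 * rho) <= s + 17 * n by move: Pw; rewrite /P; lia.
exists y, (B :|: A :|: [set y]), w; split=> //.
  exact: walk_cat (walk_cat WB W) (walk_wait g y tE).
apply: (@leq_trans #|A :&: Y|).
  by apply: leq_trans (ltnW big); rewrite -(expnMn 2 w 2) leq_exp2r //; lia.
by apply: subset_leq_card; rewrite setSI // -setUA setUCA subsetUl.
Qed.

End Exploration.

Import Order.TTheory GRing.Theory Num.Theory.
Local Open Scope ring_scope.

(** * Geometric decay of the unvisited set *)

Section Decay.
Variables (R : realType) (V : finType) (g : nat -> rel V) (U : rel V).
Hypothesis gconn : forall t x y, connect (g t) x y.
Hypothesis gsym : forall t, symmetric (g t).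
Hypothesis gU : forall t x y, g t x y -> U x y.
Hypothesis V_gt1 : (1 < #|V|)%N.
Let n : R := #|V|%:R.
Let Delta : R := (\sum_v deg U v)%N%:R / n.
Variable K : R.
Hypothesis K_ge1 : 1 <= K.
Hypothesis K_cube : 896 ^+ 2 * Delta ^+ 2 * n <= K ^+ 3.

(** Square the bound [y <= 896 * Delta * w.+1 ^ 3], multiply by [y <= n] and take cube roots: a
    phase visits a [1 / K] share of what is left. *)
Lemma gain_ge (y w : nat) : (0 < y <= #|V|)%N ->
  (#|V| * y < 896 * (\sum_v deg U v) * w.+1 ^ 3)%N -> y%:R / K <= (w.+1 ^ 2)%:R.
Proof.
move=> /andP[y0 yn] H; have n0 : 0 < n by rewrite ltr0n; lia.
have K0 : 0 < K by apply: lt_le_trans K_ge1.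
have {H} H : y%:R <= 896 * Delta * w.+1%:R ^+ 3.
  have : (#|V| * y)%N%:R <= (896 * (\sum_v deg U v) * w.+1 ^ 3)%N%:R :> R by rewrite ler_nat ltnW.
  rewrite [leLHS]natrM [leRHS]natrM [X in _ <= X * _]natrM natrX -/n => H'; rewrite -(ler_pM2l n0); apply: le_trans H' _.
  by rewrite le_eqVlt /Delta; apply/orP; left; apply/eqP; field; rewrite gt_eqF.
set W := w.+1%:R in H *; have W0 : 0 <= W by exact: ler0n.
have yR : 0 <= y%:R :> R by exact: ler0n.
rewrite natrX -/W -(@ler_pXn2r _ 3) ?nnegrE ?divr_ge0 ?exprn_ge0 ?(ltW K0) //.
rewrite expr_div_n ler_pdivrMr ?exprn_gt0 //.
have D0 : 0 <= Delta by rewrite divr_ge0 ?ler0n.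
have H2 : y%:R ^+ 2 <= (896 * Delta * W ^+ 3) ^+ 2 by rewrite ler_pXn2r // nnegrE (le_trans yR H).
have yn' : y%:R <= n by rewrite ler_nat.
have -> : y%:R ^+ 3 = y%:R ^+ 2 * y%:R :> R by rewrite exprSr.
apply: (@le_trans _ _ ((896 * Delta * W ^+ 3) ^+ 2 * n)).
  by apply: ler_pM => //; exact: exprn_ge0.
have -> : (896 * Delta * W ^+ 3) ^+ 2 * n = (W ^+ 2) ^+ 3 * (896 ^+ 2 * Delta ^+ 2 * n) by ring.
by rewrite ler_wpM2l // !exprn_ge0.
Qed.

Lemma unvisited_decay (v : V) (N : nat) : exists y A,
  walk g 0 v (17 * #|V| * N) y A /\ #|~: A|%:R <= n * (1 - K^-1) ^+ N.
Proof.
have K0 : 0 < K by apply: lt_le_trans K_ge1.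
have q0 : 0 <= 1 - K^-1 by rewrite subr_ge0 invf_le1.
elim: N => [|N [y [A [W HA]]]].
  exists v, [set v]; split; first by rewrite muln0; exact: walk_refl.
  by rewrite expr0 mulr1 ler_nat max_card.
rewrite mulnS addnC.
have [A0|A0] := posnP #|~: A|.
  exists y, (A :|: [set y]); split; first by apply: walk_cat W (walk_wait g y (leq_addr _ _)).
  rewrite (_ : #|_| = 0)%N ?mulr_ge0 ?exprn_ge0 ?ler0n //.
  by apply/eqP; rewrite -leqn0 -A0; apply: subset_leq_card; rewrite setCS subsetUl.
have [z [B [w [WB big est]]]] := exploration_phase gconn gsym gU V_gt1 y (17 * #|V| * N) A0.
exists z, (A :|: B); split; first exact: walk_cat W WB.
have Cn : (0 < #|~: A| <= #|V|)%N by rewrite A0 max_card.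
have G := gain_ge Cn est.
have cE : (#|~: (A :|: B)| + #|B :&: ~: A| = #|~: A|)%N.
  by rewrite -(cardsID B (~: A)) setDE setCU addnC [B :&: _]setIC.
apply: (@le_trans _ _ (#|~: A|%:R * (1 - K^-1))).
  have : (#|~: (A :|: B)| + #|B :&: ~: A|)%N%:R = #|~: A|%:R :> R by rewrite cE.
  have : (w.+1 ^ 2)%:R <= #|B :&: ~: A|%:R :> R by rewrite ler_nat.
  rewrite natrD; move: G; lra.
by rewrite exprSr mulrA ler_wpM2r.
Qed.

(** At most [n * exp (- N / K) < 1] vertices remain unvisited. *)
Lemma full_walk (v : V) (N : nat) : K * ln n < N%:R ->
  exists y, walk g 0 v (17 * #|V| * N) y setT.
Proof.
move=> HN; have [y [A [W HA]]] := unvisited_decay v N.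
have K0 : 0 < K by apply: lt_le_trans K_ge1.
have n0 : 0 < n by rewrite ltr0n; lia.
suff /eqP A0 : #|~: A| == 0%N.
  by exists y; move/cards0_eq: A0 => /(congr1 (@setC V)); rewrite setCK setC0 => <-.
rewrite -leqn0 -ltnS -(ltr_nat R); apply: le_lt_trans HA _.
have q0 : 0 <= 1 - K^-1 by rewrite subr_ge0 invf_le1.
apply: (@le_lt_trans _ _ (n * expR (- (K^-1 * N%:R)))).
  rewrite ler_pM2l //.
  have -> : - (K^-1 * N%:R) = - K^-1 * N%:R by rewrite mulNr.
  rewrite expRM_natr lerXn2r ?nnegrE ?expR_ge0 //.
  exact: expR_ge1Dx.
rewrite -{1}(lnK (x := n)) ?posrE // -expRD expR_lt1.
by rewrite subr_lt0 mulrC ltr_pdivlMr // mulrC.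
Qed.

End Decay.

(** * Temporal walks and comparison with the bound *)

Lemma walk_temporal (V : finType) (T : nat) (G : temporal_graph V T) (g : nat -> rel V)
    (v0 y : V) (t : nat) (A : {set V}) :
  (forall i : 'I_T, g i =2 G i) -> (t <= T)%N -> walk g 0 v0 t y A ->
  exists w : seq ((V * V) * 'I_T),
    [/\ temporal_walk G v0 w, forall e, e \in w -> (e.2 < t)%N,
        last v0 [seq e.1.2 | e <- w] = y & {subset A <= visited v0 w}].
Proof.
move=> gG tT W; elim: W tT => {t y A} [_|t y A _ IH tT|t y z A _ IH gyz tT].
- exists [::]; split => // v; rewrite !inE //.
- have [w [h1 h2 h3 h4]] := IH (ltnW tT); exists w; split=> // e /h2; exact: ltnW.
have [w [/and3P[/eqP h1 h1' h1''] h2 h3 h4]] := IH (ltnW tT).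
pose i := Ordinal tT; exists (rcons w ((y, z), i)); split.
- apply/and3P; split.
  + by rewrite !map_rcons belast_rcons lastI h1 h3.
  + by rewrite all_rcons h1' andbT /= -(gG i).
  + rewrite map_rcons /=; case: w h1'' h2 {h1 h1' h3 h4} => //= e w h h2.
    rewrite rcons_path h /=; have := mem_last (val e.2) [seq val e.2 | e <- w].
    by rewrite -(map_cons (fun e : V * V * 'I_T => val e.2)) => /mapP[e' /h2 lt ->].
- move=> e; rewrite mem_rcons inE => /orP[/eqP->//|/h2]; exact: ltnW.
- by rewrite map_rcons last_rcons.
- move=> v; rewrite /visited map_rcons -rcons_cons mem_rcons !inE => /orP[->//|/h4].
  by rewrite /visited inE => ->; rewrite orbT.
Qed.

Lemma exploration_bound_ge (R : realType) (n : nat) (r b D : R) :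
  (2 <= n)%N -> 2 <= r -> 1 <= b -> 1 <= D ->
  n%:R * ln n%:R * (n%:R / r + ln 2 `^ (3 / 2) * (r `^ (1 / 2) * D `^ (3 / 2))) <=
  exploration_bound n r b D.
Proof.
move=> n2 r2 b1 D1; rewrite /exploration_bound.
set s := r `^ (1 / 2) * D `^ (3 / 2).
have n0 : 0 < n%:R :> R by rewrite ltr0n; lia.
have ln0 : 0 <= ln n%:R :> R by apply: ln_ge0; rewrite ler1n; lia.
have s0 : 0 <= s by rewrite mulr_ge0 ?powR_ge0.
have b4 : 1 <= b ^+ 4 by rewrite exprn_ege1.
have lam : ln 2 `^ (3 / 2) <= ln r `^ (3 / 2) :> R.
  have l2 : 0 <= ln 2 :> R by apply: ln_ge0; rewrite ler1n.
  have lr : ln 2 <= ln r :> R by rewrite ler_ln ?posrE //; lra.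
  by apply: ge0_ler_powR; rewrite ?nnegrE //; lra.
set l2 := ln 2 `^ (3 / 2) in lam *; set lr := ln r `^ (3 / 2) in lam *.
have l20 : 0 <= l2 by exact: powR_ge0.
have -> : n%:R * r `^ (1 / 2) * b ^+ 4 * D `^ (3 / 2) * lr * ln n%:R +
    n%:R ^+ 2 * ln n%:R / r = n%:R * ln n%:R * (n%:R / r + (b ^+ 4 * lr) * s).
  by rewrite /s; field; lra.
apply: ler_wpM2l; first by rewrite mulr_ge0 // ltW.
rewrite lerD2l ler_wpM2r //; apply: le_trans lam _.
by rewrite ler_peMl //; apply: powR_ge0.
Qed.

Theorem theorem4 (R : realType) (c : R) (hc : 0 < c) :
  exists2 C : R, 0 < C &
    forall (V : finType) (T : nat) (G : temporal_graph V T) (r b : R),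
      (2 <= #|V|)%N ->
      always_connected G ->
      2 <= r -> 1 <= b ->
      (exists S : {set V}, strict_division (underlying G) c r b S) ->
      let f := exploration_bound #|V| r b (average_degree R (underlying G)) in
      C * f <= T%:R ->
      forall v0 : V, exists w : seq ((V * V) * 'I_T),
        [/\ temporal_walk G v0 w,
            forall e, e \in w -> (e.2.+1 : int) <= Num.ceil (C * f)
          & forall v : V, v \in visited v0 w].
Proof.
have l2 : 0 < ln 2 :> R by apply: ln_gt0; rewrite ltr1n.
pose lam : R := ln 2 `^ (3 / 2); have lam0 : 0 < lam by exact: powR_gt0.
(* 17 is the phase length over [#|V|]; 93 satisfies [896 ^ 2 <= 93 ^ 3]; [(ln 2)^-1] absorbs
   rounding up the number of phases; the last factor passes from [a + s] to [a + lam * s]. *)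
pose C : R := 17 * (93 + (ln 2)^-1) * (1 + lam^-1).
have C0 : 0 < C by rewrite !mulr_gt0 ?addr_gt0 ?invr_gt0.
exists C => // V T G r b n2 conG r2 b1 _ f fT v0.
set D := average_degree R (underlying G) in f fT *.
have n0 : 0 < #|V|%:R :> R by rewrite ltr0n; lia.
have lnn : ln 2 <= ln #|V|%:R :> R by rewrite ler_ln ?posrE ?ler_nat.
have T0 : (0 < T)%N.
  rewrite -(ltr_nat R); apply: lt_le_trans fT; apply: mulr_gt0 => //.
  rewrite /f /exploration_bound; apply: ltr_wpDl.
    by rewrite !mulr_ge0 ?powR_ge0 ?exprn_ge0 ?ler0n //; lra.
  by rewrite divr_gt0 ?mulr_gt0 ?exprn_gt0 //; lra.
(* From time [T] on the first snapshot is repeated; the final walk ends by time [T]. *)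
pose g (t : nat) : rel V := G (insubd (Ordinal T0) t).
have gG (i : 'I_T) : g i =2 G i by move=> x y; rewrite /g valKd.
have gconn t x y : connect (g t) x y by exact: conG.
have gsym t : symmetric (g t) by exact: adj_sym.
have gU t x y : g t x y -> underlying G x y.
  by move=> gxy; apply/existsP; exists (insubd (Ordinal T0) t).
have DE : D = (\sum_v deg (underlying G) v)%N%:R / #|V|%:R by rewrite /D /average_degree natr_sum.
have D1 : 1 <= D.
  by rewrite DE ler_pdivlMr // mul1r ler_nat; apply: (card_le_degrees gconn gU).
pose a : R := #|V|%:R / r; pose s : R := r `^ (1 / 2) * D `^ (3 / 2).
have a0 : 0 < a by rewrite divr_gt0 //; lra.
have s0 : 0 < s by rewrite mulr_gt0 ?powR_gt0 //; lra.
have as2 : a * s ^+ 2 = #|V|%:R * D ^+ 3.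
  have -> : s ^+ 2 = r * D ^+ 3.
    have sq (x p : R) : (x `^ p) ^+ 2 = x `^ (p * 2%:R).
      by rewrite powRrM powR_mulrn // powR_ge0.
    rewrite /s exprMn !sq.
    have -> : 1 / 2 * 2%:R = 1 :> R by field.
    have -> : 3 / 2 * 2%:R = 3%:R :> R by field.
    by rewrite powRr1 ?powR_mulrn //; lra.
  by rewrite /a; field; lra.
(* The cube dominates [a * s ^+ 2 = n * D ^+ 3], and [D >= 1]. *)
have asn : #|V|%:R * D ^+ 2 <= (a + s) ^+ 3.
  apply: (@le_trans _ _ (a * s ^+ 2)).
    by rewrite as2 ler_pM2l // [leRHS]exprS ler_peMl // exprn_ge0 //; lra.
  have [h1 h2] : 0 <= a ^+ 3 /\ 0 <= s ^+ 3 by split; apply/ltW/exprn_gt0.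
  have [h3 h4] : 0 <= a ^+ 2 * s /\ 0 <= a * s ^+ 2.
    by split; apply/ltW/mulr_gt0 => //; apply: exprn_gt0.
  lra.
have as1 : 1 <= a + s.
  rewrite -(@ler_pXn2r _ 3) ?nnegrE ?expr1n //; last by lra.
  apply: le_trans asn; rewrite -[leLHS]mulr1; apply: ler_pM => //.
    by rewrite ler1n ltnW.
  by rewrite exprn_ege1.
pose K := 93 * (a + s).
have K1 : 1 <= K by rewrite /K; lra.
have Kc : 896 ^+ 2 * ((\sum_v deg (underlying G) v)%N%:R / #|V|%:R) ^+ 2 * #|V|%:R <= K ^+ 3.
  rewrite -DE /K [(93 * _) ^+ 3]exprMn.
  have -> : 896 ^+ 2 * D ^+ 2 * #|V|%:R = 896 ^+ 2 * (#|V|%:R * D ^+ 2) by ring.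
  have nD0 : 0 <= #|V|%:R * D ^+ 2 by rewrite mulr_ge0 ?exprn_ge0 ?ler0n // (le_trans ler01).
  have c3 : 896 ^+ 2 <= 93 ^+ 3 :> R by lra.
  have c0 : 0 <= 93 ^+ 3 :> R by lra.
  exact: le_trans (ler_wpM2r nD0 c3) (ler_wpM2l c0 asn).
pose N := (Num.truncn (K * ln #|V|%:R)).+1.
have KN : K * ln #|V|%:R < N%:R by rewrite /N truncnS_gt.
have [y W] := full_walk gconn gsym gU n2 K1 Kc v0 KN.
have Nf : (17 * #|V| * N)%N%:R <= C * f.
  have lnn0 : 0 < ln #|V|%:R :> R by lra.
  have N1 : N%:R <= (93 + (ln 2)^-1) * (a + s) * ln #|V|%:R.
    have trN : (Num.truncn (K * ln #|V|%:R))%:R <= K * ln #|V|%:R.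
      by rewrite truncn_le // mulr_ge0 //; lra.
    have one : 1 <= (ln 2)^-1 * (a + s) * ln #|V|%:R.
      rewrite -mulrA mulrC ler_pdivlMr // mul1r; apply: le_trans lnn _.
      by rewrite ler_peMl // ltW.
    have -> : (93 + (ln 2)^-1) * (a + s) * ln #|V|%:R =
        K * ln #|V|%:R + (ln 2)^-1 * (a + s) * ln #|V|%:R by rewrite /K; ring.
    by rewrite /N -natr1; apply: lerD.
  have as' : a + s <= (1 + lam^-1) * (a + lam * s).
    have -> : (1 + lam^-1) * (a + lam * s) = a + s + (lam^-1 * a + lam * s).
      by field; rewrite gt_eqF.
    by rewrite lerDl addr_ge0 // mulr_ge0 ?invr_ge0 // ltW.
  apply: (@le_trans _ _ (C * (#|V|%:R * ln #|V|%:R * (a + lam * s)))); last first.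
    by rewrite ler_pM2l //; apply: exploration_bound_ge.
  have -> : C * (#|V|%:R * ln #|V|%:R * (a + lam * s)) =
      17 * #|V|%:R * ((93 + (ln 2)^-1) * ((1 + lam^-1) * (a + lam * s)) * ln #|V|%:R).
    by rewrite /C; ring.
  rewrite natrM natrM ler_pM2l ?mulr_gt0 //; apply: le_trans N1 _.
  by rewrite ler_pM2r // ler_pM2l // addr_gt0 ?invr_gt0.
have NT : (17 * #|V| * N <= T)%N by rewrite -(ler_nat R); apply: le_trans fT.
have [w [w1 w2 w3 w4]] := walk_temporal gG NT W.
exists w; split=> // [e /w2 et|v]; last by apply: w4; rewrite inE.
(* Time [e.2] means snapshot number [e.2.+1], so the strict bound on [e.2] is just what is
   needed. *)
rewrite -(ler_int R); apply: le_trans (ceil_ge _); apply: le_trans Nf.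
by rewrite -pmulrn ler_nat.
Qed.
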